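(* Let $c>0$, and assume that $\overline{\Phi}=(\overline\phi_1,\dots,\overline\phi_m)$ and $\underline{\Phi}=(\underline\phi_1,\dots,\underline\phi_m)$ are a pair of generalized upper and lower solutions (defined in the context) of the wave profile system $$\phi_i(\xi)=\int_{\mathbb R}P_i\big[\phi_1(s-\tau c+c),\dots,\phi_1(s),\phi_2(s-\tau c+c),\dots,\phi_m(s)\big]\,k_i(\xi-s-c)\,ds,\qquad i\in I,\ \xi\in\mathbb R. \qquad (W)$$ Then (W) admits a positive solution $\Phi=(\phi_1,\dots,\phi_m)\in C$ such that $\underline{\Phi}(\xi)\le\Phi(\xi)\le\overline{\Phi}(\xi)$ (componentwise) for all $\xi\in\mathbb R$.
   Context: Let $m,\tau\in\mathbb N$, $I=\{1,\dots,m\}$, $J=\{1,\dots,\tau\}$. $C$ is the set of uniformly continuous bounded functions $\mathbb R\to\mathbb R^m$; inequalities between vectors are componentwise, and $\mathbf a\ll\mathbf b$ means strict inequality in every component. For vectors $\mathbf A\le\mathbf B$, $C_{[\mathbf A,\mathbf B]}=\{U\in C:\mathbf A\le U(x)\le\mathbf B\ \forall x\}$. The functions $P_i:\mathbb R^{m\times\tau}\to\mathbb R$ ($i\in I$), with arguments ordered as $[h_{11},h_{12},\dots,h_{1\tau},h_{21},\dots,h_{m\tau}]$, satisfy: (P1) there is $\mathbf M=(M_1,\dots,M_m)$ such that $0\le P_i[h_{11},\dots,h_{m\tau}]\le M_i$ for all $i\in I$ whenever $0\le h_{lj}\le M_l$ for all $l\in I,j\in J$; (P2) there is $L>0$ with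 $|P_i[h_{11},\dots,h_{m\tau}]-P_i[f_{11},\dots,f_{m\tau}]|\le L\sum_{l\in I,j\in J}|h_{lj}-f_{lj}|$ whenever $h_{lj},f_{lj}\in[0,M_l]$; (P3) $P_i[0,\dots,0]=0$ and there is $\mathbf E=(E_1,\dots,E_m)$ with $P_i[E_1,\dots,E_1,E_2,\dots,E_2,\dots,E_m,\dots,E_m]=E_i$ (each $E_l$ repeated $\tau$ times) for all $i\in I$; (P4) $\mathbf 0\ll\mathbf E\le\mathbf M$. The kernels $k_i:\mathbb R\to[0,\infty)$ satisfy: (k1) $k_i$ is Lebesgue measurable and integrable; (k2) $k_i(x)=k_i(-x)$; (k3) $\int_{\mathbb R}k_i(y)\,dy=1$ and $\int_{\mathbb R}k_i(y)e^{\lambda y}dy<\infty$ for every $\lambda\ge0$. In (W) the arguments of $P_i$ are, in order, $\phi_l(s-(\tau-j)c)$ for $l\in I$, $j=1,\dots,\tau$. Generalized upper and lower solutions: $\overline\Phi,\underline\Phi\in C_{[\mathbf 0,\mathbf M]}$ are a pair of generalized upper and lower solutions of (W) if for all $i\in I$, $\xi\in\mathbb R$, and all uniformly continuous functions $\psi_{lj}:\mathbb R\to\mathbb R$ with $\underline\phi_l(\xi)\le\psi_{lj}(\xi)\le\overline\phi_l(\xi)$ for all $l\in I,j\in J,\xi\in\mathbb R$, $$\underline\phi_i(\xi)\le\int_{\mathbb R}P_i\big[\psi_{11}(s-\tau c+c),\dots,\psi_{1\tau}(s),\psi_{21}(s-\tau c+c),\dots,\psi_{m\tau}(s)\big]k_i(\xi-s-c)\,ds\le\overline\phi_i(\xi),$$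 where $\psi_{lj}$ is evaluated at $s-(\tau-j)c$. (The paper remarks that the definition implies $\underline\Phi\le\overline\Phi$.)
   Formalization: ''Positive'' is read as componentwise nonnegative, since the zero pair of upper and lower solutions admits only the zero solution; the ordering of the lower below the upper solution, which the definition does not force when no admissible ψ exists, is made part of the definition. *)

(* Defs.v *)
From HB Require Import structures.
From mathcomp Require Import all_boot all_order all_algebra.
From mathcomp Require Import all_classical all_reals all_analysis.
Set Implicit Arguments.
Unset Strict Implicit.
Unset Printing Implicit Defensive.
Import Order.TTheory GRing.Theory Num.Theory.
Import numFieldNormedType.Exports.
Local Open Scope classical_set_scope.
Local Open Scope ring_scope.

Definition vec_le (R : realType) (m : nat) (a b : 'rV[R]_m) : Prop :=
  forall i : 'I_m, a 0 i <= b 0 i.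

Definition vec_ll (R : realType) (m : nat) (a b : 'rV[R]_m) : Prop :=
  forall i : 'I_m, a 0 i < b 0 i.

Definition fun_le (R : realType) (m : nat) (U V : R -> 'rV[R]_m) : Prop :=
  forall x : R, vec_le (U x) (V x).

(* Uniformly continuous and bounded for the sup norm and uniformity of 'rV[R]_m. *)
Definition BUC (R : realType) (m : nat) (U : R -> 'rV[R]_m) : Prop :=
  unif_continuous U /\ bounded_fun U.

Definition BUC_itv (R : realType) (m : nat) (A B : 'rV[R]_m)
    (U : R -> 'rV[R]_m) : Prop :=
  BUC U /\ forall x : R, vec_le A (U x) /\ vec_le (U x) B.

(* The m * tau arguments h_lj of P_i are the entries of a matrix h, so that
   their order [h_11, ..., h_1tau, h_21, ..., h_mtau] is row-major. *)
Definition in_box (R : realType) (m tau : nat) (M : 'rV[R]_m)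
    (h : 'M[R]_(m, tau)) : Prop :=
  forall (l : 'I_m) (j : 'I_tau), 0 <= h l j <= M 0 l.

Record growth_assumptions (R : realType) (m tau : nat)
    (P : 'I_m -> 'M[R]_(m, tau) -> R) (M E : 'rV[R]_m) : Prop := {
  growth_bounded : forall (i : 'I_m) (h : 'M[R]_(m, tau)),
    in_box M h -> 0 <= P i h <= M 0 i ;
  growth_lipschitz : exists2 L : R, 0 < L &
    forall (i : 'I_m) (h f : 'M[R]_(m, tau)), in_box M h -> in_box M f ->
      `|P i h - P i f| <= L * \sum_(l < m) \sum_(j < tau) `|h l j - f l j| ;
  growth_zero : forall i : 'I_m, P i 0 = 0 ;
  growth_equilibrium : forall i : 'I_m, P i (\matrix_(l, j) E 0 l) = E 0 i ;
  growth_equilibrium_pos : vec_ll 0 E ;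
  growth_equilibrium_le : vec_le E M
}.

(* The completed measure is used because the kernels are only assumed to be
   Lebesgue, not Borel, measurable; [integrable] includes measurability. *)
Record kernel_assumptions (R : realType) (k : R -> R) : Prop := {
  kernel_ge0 : forall x : R, 0 <= k x ;
  kernel_integrable :
    (@completed_lebesgue_measure R).-integrable setT (EFin \o k) ;
  kernel_even : forall x : R, k x = k (- x) ;
  kernel_mass1 :
    (\int[@completed_lebesgue_measure R]_y (k y)%:E = 1)%E ;
  kernel_exp_moment : forall lambda : R, 0 <= lambda ->
    (\int[@completed_lebesgue_measure R]_y (k y * expR (lambda * y))%:E
       < +oo)%E
}.

(* psi_lj evaluated at s - (tau - j) c for the 1-based index j, which is j.+1
   for j : 'I_tau. *)
Definition delayed_args (R : realType) (m tau : nat) (c : R)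
    (psi : 'I_m -> 'I_tau -> R -> R) (s : R) : 'M[R]_(m, tau) :=
  \matrix_(l, j) psi l j (s - (tau - j.+1)%:R * c).

Definition profile_integral (R : realType) (m tau : nat)
    (P : 'I_m -> 'M[R]_(m, tau) -> R) (k : 'I_m -> R -> R) (c : R)
    (psi : 'I_m -> 'I_tau -> R -> R) (i : 'I_m) (xi : R) : R :=
  \int[@completed_lebesgue_measure R]_s
    (P i (delayed_args c psi s) * k i (xi - s - c)).

Definition wave_profile_solution (R : realType) (m tau : nat)
    (P : 'I_m -> 'M[R]_(m, tau) -> R) (k : 'I_m -> R -> R) (c : R)
    (Phi : R -> 'rV[R]_m) : Prop :=
  forall (i : 'I_m) (xi : R),
    Phi xi 0 i = profile_integral P k c (fun l _ x => Phi x 0 l) i xi.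

(* The ordering of the pair is required explicitly: without it the condition
   on psi would hold vacuously for pairs admitting no intermediate psi. *)
Record generalized_upper_lower (R : realType) (m tau : nat)
    (P : 'I_m -> 'M[R]_(m, tau) -> R) (k : 'I_m -> R -> R) (M : 'rV[R]_m)
    (c : R) (Phi_up Phi_lo : R -> 'rV[R]_m) : Prop := {
  gul_upper : BUC_itv 0 M Phi_up ;
  gul_lower : BUC_itv 0 M Phi_lo ;
  gul_ordered : fun_le Phi_lo Phi_up ;
  gul_between : forall psi : 'I_m -> 'I_tau -> R -> R,
    (forall l j, unif_continuous (psi l j)) ->
    (forall l j x, Phi_lo x 0 l <= psi l j x <= Phi_up x 0 l) ->
    forall (i : 'I_m) (xi : R),
      Phi_lo xi 0 i <= profile_integral P k c psi i xi <= Phi_up xi 0 i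
}.

(* Main.v *)
Require Import Defs.
From HB Require Import structures.
From mathcomp Require Import all_boot all_order all_algebra fingroup perm.
From mathcomp Require Import all_classical all_reals all_analysis.
From mathcomp Require Import measurable_realfun.
From mathcomp Require Import ring lra zify.
Set Implicit Arguments.
Unset Strict Implicit.
Unset Printing Implicit Defensive.
Import Order.TTheory GRing.Theory Num.Theory.
Import numFieldNormedType.Exports.
Local Open Scope classical_set_scope.
Local Open Scope ring_scope.

(** A profile is a fixed point of the operator F that sends Phi to the right-hand
    side of the wave system. The definition of generalized upper and lower
    solutions makes F map into itself the convex set of uniformly
    continuous Phi lying between the two solutions; what has to be supplied is
    the compactness needed for a fixed point theorem of Schauder type.

    It comes from the convolution: since P_i is bounded by M_i, the component
    F(Phi)_i is 1-Lipschitz for the pseudometric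
    d_i(x, y) = M_i int |k_i(x - s - c) - k_i(y - s - c)| ds,
    which does not depend on Phi. This pseudometric is small when x and y are
    close because translations act continuously on L1 (kernel_dist_small, from
    integrable_L1_continuous and translate_setD_small).

    The fixed point (fixed_point_between) is found by discretization. Values
    v_p prescribed at finitely many nodes q_p define the 1-Lipschitz function
    min_p (v_p + d_i(x, q_p)), which is then truncated between the lower and
    the upper solution. The values of F at the nodes are a continuous function
    of the vector v on a box, so brouwer_approx makes v almost equal to these
    values, and the Lipschitz bounds make the interpolant almost fixed by F near
    the nodes. With more and more nodes from a dense sequence, a subsequence
    converges pointwise, and dominated convergence (cvg_Rintegral_mul) carries
    the equation to the limit.

    The approximate Brouwer theorem rests on a cubical lemma of Sperner type
    (cubical_sperner), proved by a mod 2 degree argument. For 0-1 labels a_i on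
    a grid, equal to 0 on the face y_i = 0 and to 1 on the opposite one, sum over
    the simplices of the triangulated cube the cup product of the coboundaries
    of the a_i. By the Stokes formula the sum depends only on the values on the
    boundary, and it is 1 for the labels y_i > 0. Hence some simplex carries a
    nonzero product, and each label takes both values on it. *)

(** * Cup products mod 2 *)

Lemma addrr_F2 (x : 'F_2) : x + x = 0.
Proof. by apply: addrr_pchar2; apply: pchar_Fp. Qed.

Lemma addr_eq0_F2 (x y : 'F_2) : x + y = 0 -> x = y.
Proof. by move=> h; rewrite -[x]addr0 -(addrr_F2 y) addrA h add0r. Qed.

Lemma bump_ge h k : (h <= k)%N -> bump h k = k.+1.
Proof. by rewrite /bump => ->. Qed.

Lemma bump_lt h k : (k < h)%N -> bump h k = k.
Proof. by rewrite ltnNge /bump => /negbTE ->. Qed.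

Section Cup.
Variable V : Type.
Implicit Types (a b : nat -> V -> 'F_2) (d : V -> 'F_2) (v w : nat -> V).

(** The cup product of the mod 2 coboundaries of a 0, ..., a (n - 1), evaluated
    on the simplex with vertices v 0, ..., v n. *)
Definition cup n a v : 'F_2 := \prod_(l < n) (a l (v l) + a l (v l.+1)).

Lemma eq_cup n a v w : (forall k, (k <= n)%N -> v k = w k) ->
  cup n a v = cup n a w.
Proof. by move=> h; apply: eq_bigr => l _; rewrite !h // ltnW. Qed.

Lemma cup_eq0 n a v l : (l < n)%N -> a l (v l) = a l (v l.+1) -> cup n a v = 0.
Proof.
by move=> ln e; rewrite /cup (bigD1 (Ordinal ln)) //= e addrr_F2 mul0r.
Qed.

(** A product of coboundaries is a cocycle: it vanishes on the boundary of any
    simplex with vertices v 0, ..., v (n + 1). The face opposite to v j is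
    v \o bump j. *)
Lemma cup_cocycle n a v : \sum_(j < n.+2) cup n a (v \o bump j) = 0.
Proof.
elim: n => [|n IH]; first by rewrite !big_ord_recr /= /cup !big_ord0 add0r addrr_F2.
rewrite big_ord_recr /= big_ord_recr /=.
have -> : \sum_(j < n.+1) cup n.+1 a (v \o bump j) =
   (\sum_(j < n.+1) cup n a (v \o bump j)) * (a n (v n.+1) + a n (v n.+2)).
  rewrite big_distrl /=; apply: eq_bigr => j _.
  rewrite /cup big_ord_recr /= !bump_ge //; have := ltn_ord j; lia.
move: IH; rewrite big_ord_recr /= => /addr_eq0_F2 ->.
have C j w : (n < j)%N -> cup n a (w \o bump j) = cup n a w.
  by move=> nj; apply: eq_cup => k kn /=; rewrite bump_lt //; lia.
rewrite {2 3}/cup 2!big_ord_recr /= -/(cup n a (v \o bump n.+1)).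
rewrite -/(cup n a (v \o bump n.+2)) !C // (bump_ge (leqnn _)) !bump_lt //.
rewrite -!mulrDr [X in _ * X](_ : _ = 0) ?mulr0 //.
move: (a n _) (a n _) (a n _) => x y z.
have -> : z + y + (x + y) + (x + z) = (x + x) + (y + y) + (z + z) by ring.
by rewrite !addrr_F2.
Qed.

(** The Leibniz rule for a product of coboundaries in which the factor d alone
    is not differentiated: its coboundary is the full product. Faces j <= i
    see d at v (i + 1) and the others see it at v i, and on each of the two
    groups the cocycle property evaluates the sum. *)
Lemma cup_leibniz i n a b d v :
  \sum_(j < i.+1 + n.+1)
     (cup i a (v \o bump j) * d (v (bump j i))
      * cup n b (fun k => v (bump j (i + k)))) =
  cup i a v * (d (v i) + d (v i.+1)) * cup n b (fun k => v (i.+1 + k)%N).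
Proof.
rewrite big_split_ord /=.
have -> : \sum_(j < i.+1) (cup i a (v \o bump j) * d (v (bump j i))
      * cup n b (fun k => v (bump j (i + k)))) =
   (\sum_(j < i.+1) cup i a (v \o bump j)) * (d (v i.+1) *
      cup n b (fun k => v (i.+1 + k)%N)).
  rewrite big_distrl /=; apply: eq_bigr => j _; rewrite -mulrA.
  have jn := ltn_ord j; rewrite (@bump_ge _ i) //.
  by congr (_ * (_ * _)); apply: eq_cup => k _; rewrite bump_ge //; lia.
have -> : \sum_(j < n.+1) (cup i a (v \o bump (i.+1 + j)) * d (v (bump (i.+1 + j) i))
      * cup n b (fun k => v (bump (i.+1 + j) (i + k)))) =
   cup i a v * d (v i) *
     \sum_(j < n.+1) cup n b ((fun k => v (i + k)%N) \o bump (lift ord0 j)).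
  rewrite big_distrr /=; apply: eq_bigr => j _; rewrite (@bump_lt _ i); last lia.
  congr (_ * _ * _); apply: eq_cup => k kn /=; first by rewrite bump_lt //; lia.
  by congr v; rewrite /bump; lia.
have := cup_cocycle i a v; rewrite big_ord_recr /= => /addr_eq0_F2 ->.
have := cup_cocycle n b (fun k => v (i + k)%N).
rewrite big_ord_recl /= => /addr_eq0_F2 <-.
have -> : cup i a (v \o bump i.+1) = cup i a v.
  by apply: eq_cup => k ki /=; rewrite bump_lt.
have -> : cup n b ((fun k => v (i + k)%N) \o bump 0) = cup n b (fun k => v (i.+1 + k)%N).
  by apply: eq_cup => k _ /=; rewrite bump_ge // addnS.
by ring.
Qed.

Lemma cup_split i n a v : cup (i + n.+1) a v =
  cup i a v * (a i (v i) + a i (v i.+1)) *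
  cup n (fun k => a (i.+1 + k)%N) (fun k => v (i.+1 + k)%N).
Proof.
rewrite /cup big_split_ord big_ord_recl /= addn0 mulrA; congr (_ * _).
by apply: eq_bigr => k _; rewrite /bump leq0n add1n !addnS addSn.
Qed.
End Cup.

(** * Degree mod 2 of a labelling of the cube *)

Section CubeStokes.
Variables (n p : nat).
Local Notation N := n.+1.
Local Notation point := {ffun 'I_N -> nat}.
Local Notation cell := {ffun 'I_N -> 'I_p}.

(** The simplices of the Freudenthal triangulation: those in the cube with
    lowest corner x correspond to the permutations s, which give the order in
    which the coordinates of the moving vertex are increased. *)
Definition chain_vertex (x : cell) (s : {perm 'I_N}) (k : nat) : point :=
  [ffun l => (x l + (s l < k))%N].

Lemma sum_perm_paired (i j : 'I_N) (G : {perm 'I_N} -> 'F_2) : i != j ->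
  (forall s, G (s * tperm i j)%g = G s) -> \sum_s G s = 0.
Proof.
move=> ij GE; rewrite (bigID (@odd_perm _)) /=.
rewrite [X in _ + X](reindex_inj (mulIg (tperm i j))) /=.
rewrite [X in _ + X](eq_big (@odd_perm _) G) ?addrr_F2 // => s.
by rewrite odd_permM odd_tperm ij addbT negbK.
Qed.

(** Summation by parts in direction i: the terms that do not telescope lie on
    the two faces of the cube orthogonal to i, where g vanishes. *)
Lemma sum_shift (i : 'I_N) (g : point -> 'F_2) :
  (forall y : point, y i = 0%N -> g y = 0) ->
  (forall y : point, y i = p -> g y = 0) ->
  \sum_(x : cell) g [ffun l => (x l + (l == i))%N] =
  \sum_(x : cell) g [ffun l => x l : nat].
Proof.
move=> g0 gp.
pose h (x : cell) : cell := [ffun l => if l == i then ordS (x l) else x l].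
have hI : injective h.
  move=> x y /ffunP hxy; apply/ffunP => l; have := hxy l; rewrite !ffunE.
  by case: eqP => // _; apply: (can_inj (@ordSK _)).
rewrite [RHS](reindex_inj hI); apply: eq_bigr => x _.
have [xp|xp] := eqVneq (x i).+1 p.
  rewrite gp; last by rewrite ffunE eqxx addn1.
  by rewrite g0 // !ffunE eqxx /= xp modnn.
congr g; apply/ffunP => l; rewrite !ffunE; case: eqP => [->|_] /=.
  by rewrite addn1 modn_small // ltn_neqAle xp ltn_ord.
by rewrite addn0.
Qed.

(** Stokes formula mod 2. A face of a simplex that does not lie in the boundary
    of the cube is shared by exactly two simplices, hence does not count. *)
Lemma cube_stokes (w : (nat -> point) -> 'F_2) :
  (forall u v, (forall k, (k <= n)%N -> u k = v k) -> w u = w v) ->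
  (forall (u : nat -> point) i, (forall k, (k <= n)%N -> u k i = 0%N) -> w u = 0) ->
  (forall (u : nat -> point) i, (forall k, (k <= n)%N -> u k i = p) -> w u = 0) ->
  \sum_x \sum_s \sum_(j < N.+1) w (chain_vertex x s \o bump j) = 0.
Proof.
move=> wE w0 wp.
transitivity (\sum_(j < N.+1) \sum_x \sum_s w (chain_vertex x s \o bump j)).
  by rewrite [RHS]exchange_big; apply: eq_bigr => x _; rewrite exchange_big.
rewrite big_ord_recl big_ord_recr /=.
(* An inner face is shared by two simplices of the same cube, obtained from
   each other by exchanging two consecutive steps. *)
rewrite [X in _ + (X + _)]big1 ?add0r => [|j _]; last first.
  apply: big1 => x _.
  pose i1 : 'I_N := inord j; pose i2 : 'I_N := inord j.+1.
  have v1 : i1 = j :> nat by rewrite inordK //; have := ltn_ord j; lia.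
  have v2 : i2 = j.+1 :> nat by rewrite inordK //; have := ltn_ord j; lia.
  have i12 : i1 != i2 by apply/eqP => /(congr1 val) /=; rewrite v1 v2; lia.
  apply: (sum_perm_paired i12) => s; apply: wE => k kn /=.
  apply/ffunP => l; rewrite !ffunE permM; congr (_ + _)%N.
  have jn := ltn_ord j.
  case: tpermP => [->|->|_ _] //; rewrite v1 v2 /bump /=; lia.
(* The face without its lowest vertex is the face without its highest vertex
   of a simplex of the next cube, whose order of steps is shifted cyclically. *)
pose c : {perm 'I_N} := perm (@ord_pred_inj N).
rewrite exchange_big [X in _ + X]exchange_big /=.
rewrite [X in _ + X](reindex_inj (mulIg c)) /= -big_split /=.
apply: big1 => s _; pose i := (s^-1)%g ord0.
have si : s i = ord0 by rewrite permKV.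
pose g (y : point) := w (fun k => [ffun l => (y l + ((s * c)%g l < k))%N]).
have cE l : (s * c)%g l = ((s l + n) %% N)%N :> nat.
  by rewrite permM permE /= addnS.
have ci : (s * c)%g i = n :> nat by rewrite cE si add0n modn_small.
have cj l : l != i -> (s * c)%g l = (s l).-1 :> nat.
  rewrite cE => li; have : s l != ord0 by rewrite -si (inj_eq perm_inj).
  rewrite -val_eqE /=; case: (s l) => [[|t] tN] //= _.
  by rewrite addSnnS modnDr modn_small //; lia.
apply/eqP; rewrite -[X in X + _](_ : \sum_(x : cell) g [ffun l => (x l + (l == i))%N] = _).
  rewrite sum_shift; last 2 first.
  - by move=> y yi; apply: (w0 _ i) => k kn; rewrite ffunE yi ci; lia.
  - by move=> y yi; apply: (wp _ i) => k kn; rewrite ffunE yi ci; lia.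
  apply/eqP; rewrite -big_split /= big1 // => x _.
  apply/eqP; rewrite -[X in _ + X](_ : g [ffun l => x l : nat] = _) ?addrr_F2 //.
  apply: wE => k kn /=; apply/ffunP => l; rewrite !ffunE bump_lt //.
apply: eq_bigr => x _; apply: wE => k kn /=; apply/ffunP => l; rewrite !ffunE.
have [->|li] := eqVneq l i; first by rewrite si ci /bump /=; lia.
rewrite cj // /bump /=; have : s l != ord0 by rewrite -si (inj_eq perm_inj).
by rewrite -val_eqE /=; lia.
Qed.

Definition cells_sum (a : 'I_N -> point -> 'F_2) : 'F_2 :=
  \sum_x \sum_s \prod_(l < N) (a l (chain_vertex x s l) + a l (chain_vertex x s l.+1)).

(** The difference of the two sums is the sum of a coboundary, by the Leibniz
    rule; the corresponding cochain vanishes on the faces of the cube, because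
    there a i and a' i agree and the other labels are constant. *)
Lemma cells_sum_replace (i : 'I_N) (a a' : 'I_N -> point -> 'F_2) :
  (forall l, l != i -> a l = a' l) ->
  (forall l (y z : point), y l = 0%N -> z l = 0%N -> a l y = a l z) ->
  (forall l (y z : point), y l = p -> z l = p -> a l y = a l z) ->
  (forall y : point, y i = 0%N -> a i y = a' i y) ->
  (forall y : point, y i = p -> a i y = a' i y) ->
  cells_sum a = cells_sum a'.
Proof.
move=> aa' a0 ap ai0 aip; apply: addr_eq0_F2.
pose d y := a i y + a' i y.
pose al k := a (inord k).
have iN := ltn_ord i.
pose be k := a (inord (i.+1 + k)).
pose w v := cup i al v * d (v i) * cup (n - i) be (fun k => v (i + k)%N).
have w_face (u : nat -> point) (l : 'I_N) q :
  (forall y : point, y i = q -> a i y = a' i y) ->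
  (forall l (y z : point), y l = q -> z l = q -> a l y = a l z) ->
  (forall k, (k <= n)%N -> u k l = q) -> w u = 0.
  move=> aiq aq uq; rewrite /w.
  have [li|li|/val_inj li] := ltngtP l i.
  - by rewrite (@cup_eq0 _ _ _ _ l) ?mul0r // /al inord_val; apply: aq; rewrite uq //; lia.
  - rewrite (@cup_eq0 _ _ be _ (l - i.+1)) ?mulr0 //; first by have := ltn_ord l; lia.
    rewrite /be subnKC // inord_val; have := ltn_ord l.
    by move=> lN; apply: aq; rewrite uq //; lia.
  - by rewrite /d aiq -?li ?uq ?addrr_F2 ?mulr0 ?mul0r //; have := ltn_ord l; lia.
rewrite /cells_sum -big_split /= -[RHS](@cube_stokes w) => [|u v uv|u l u0|u l up].
- apply: eq_bigr => x _; rewrite -big_split /=; apply: eq_bigr => s _.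
  have EN : (N = i + (n - i).+1)%N by lia.
  have cellE b : \prod_(l < N) (b l (chain_vertex x s l) + b l (chain_vertex x s l.+1)) =
      cup (i + (n - i).+1) (fun k => b (inord k)) (chain_vertex x s).
    by rewrite -EN; apply: eq_bigr => l _; rewrite inord_val.
  rewrite 2!cellE 2!cup_split inord_val.
  rewrite -(big_mkord xpredT (fun j => w (chain_vertex x s \o bump j))).
  rewrite (_ : N.+1 = i.+1 + (n - i).+1)%N; last lia.
  rewrite big_mkord cup_leibniz /d.
  have <- : cup i al (chain_vertex x s) = cup i (fun k => a' (inord k)) (chain_vertex x s).
    apply: eq_bigr => l _; rewrite /al aa' //; apply/eqP => /(congr1 val) /=.
    by rewrite inordK; have := ltn_ord l; lia.
  have <- : cup (n - i) be (fun k => chain_vertex x s (i.+1 + k)%N) =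
      cup (n - i) (fun k => a' (inord (i.+1 + k))) (fun k => chain_vertex x s (i.+1 + k)%N).
    apply: eq_bigr => l _; rewrite /be aa' //; apply/eqP => /(congr1 val) /=.
    by rewrite inordK; have := ltn_ord l; lia.
  by rewrite -/al -/be; ring.
- rewrite /w uv; last lia.
  by congr (_ * _ * _); apply: eq_cup => k ki; apply: uv; lia.
- exact: (w_face _ l 0%N).
- exact: (w_face _ l p).
Qed.

(** Only the simplex at the origin whose steps follow the natural order
    contributes. *)
Lemma cells_sum_coordinates : (0 < p)%N ->
  cells_sum (fun i (y : point) => (0 < y i)%N%:R) = 1.
Proof.
move=> p0; pose x0 : cell := [ffun=> Ordinal p0].
have prodE x s : \prod_(l < N) ((0 < chain_vertex x s l l)%N%:R
    + (0 < chain_vertex x s l.+1 l)%N%:R) = ((x == x0) && (s == 1%g))%:R :> 'F_2.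
  have [/andP [/eqP -> /eqP ->]|xs] := boolP (_ && _).
    rewrite big1 // => l _; rewrite !ffunE perm1 /= ltnn ltnSn.
    by rewrite addn0 addn1 add0r.
  have [l hl] : exists l, ~~ ((x l == 0 :> nat) && (s l == l)).
    apply/existsP; rewrite -negb_forall; apply: contra xs => /forallP h.
    apply/andP; split; apply/eqP.
      apply/ffunP => l; rewrite ffunE; apply: val_inj => /=.
      by have /andP[/eqP] := h l.
    by apply/permP => l; rewrite perm1; have /andP[_ /eqP] := h l.
  rewrite (bigD1 l) //= !ffunE /= [X in X * _](_ : _ = 0) ?mul0r //.
  case: (posnP (x l)) hl => [xl0|xl _]; last by rewrite !ltn_addr //= addrr_F2.
  rewrite xl0 /= -val_eqE /= !add0n => sl.
  by have -> : (s l < l.+1)%N = (s l < l)%N; [lia | rewrite addrr_F2].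
transitivity (\sum_(x : cell) \sum_(s : {perm 'I_N}) ((x == x0) && (s == 1%g))%:R : 'F_2).
  by apply: eq_bigr => x _; apply: eq_bigr => s _; exact: prodE.
rewrite (bigD1 x0) //= [X in _ + X]big1 => [|x xx]; last first.
  by apply: big1 => s _; rewrite (negbTE xx).
rewrite addr0 (bigD1 1%g) //= big1 => [|s ss]; last by rewrite (negbTE ss) andbF.
by rewrite addr0 !eqxx.
Qed.

(** The labels are exchanged for the signs of the coordinates one at a time. *)
Lemma cells_sum_eq1 (a : 'I_N -> point -> bool) : (0 < p)%N ->
  (forall l (y : point), y l = 0%N -> a l y = false) ->
  (forall l (y : point), y l = p -> a l y = true) ->
  cells_sum (fun i y => (a i y)%:R) = 1.
Proof.
move=> p0 a0 ap.
pose h t (i : 'I_N) (y : point) : 'F_2 :=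
  (if (i < t)%N then (0 < y i)%N else a i y)%:R.
have h0 t l (y : point) : y l = 0%N -> h t l y = 0.
  by rewrite /h => yl; rewrite a0 // yl ltnn if_same.
have hp t l (y : point) : y l = p -> h t l y = 1.
  by rewrite /h => yl; rewrite ap // yl p0 if_same.
suff hE t : (t <= N)%N -> cells_sum (h 0%N) = cells_sum (h t).
  rewrite [LHS](hE N (leqnn _)) -(cells_sum_coordinates p0); congr cells_sum.
  by apply/funext => i; apply/funext => y; rewrite /h ltn_ord.
elim: t => // t IH tN; rewrite IH; last exact: ltnW.
apply: (@cells_sum_replace (Ordinal tN)) => [l lt|l y z ? ?|l y z ? ?|y ?|y ?].
- apply/funext => y; rewrite /h ltnS [(l <= t)%N]leq_eqVlt.
  by move: lt; rewrite -val_eqE /= => /negbTE ->.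
- by rewrite !h0.
- by rewrite !hp.
- by rewrite !h0.
- by rewrite !hp.
Qed.
End CubeStokes.

(** A cubical form of the lemma of Sperner. Some simplex contributes to the sum,
    which is odd; along it every label takes both values. *)
Lemma cubical_sperner (N p : nat) (a : 'I_N -> {ffun 'I_N -> nat} -> bool) :
  (0 < p)%N ->
  (forall l (y : {ffun 'I_N -> nat}), y l = 0%N -> a l y = false) ->
  (forall l (y : {ffun 'I_N -> nat}), y l = p -> a l y = true) ->
  exists x : {ffun 'I_N -> 'I_p}, forall i : 'I_N,
    exists e e' : {ffun 'I_N -> bool},
    a i [ffun l => (x l + e l)%N] = false /\
    a i [ffun l => (x l + e' l)%N] = true.
Proof.
case: N a => [|n] a p0 a0 ap.
  by exists [ffun=> Ordinal p0]; case.
have S1 := cells_sum_eq1 p0 a0 ap.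
have [x [s xs]] : exists x s, \prod_(l < n.+1) ((a l (@chain_vertex n p x s l))%:R +
      (a l (chain_vertex x s l.+1))%:R) != 0 :> 'F_2.
  apply: contrapT => H; move: S1; rewrite /cells_sum big1 => [/eqP|x _].
    by rewrite eq_sym oner_eq0.
  apply: big1 => s _; apply/eqP; apply: contrapT => /negP h.
  by apply: H; exists x, s.
exists x => i; move: xs; rewrite (bigD1 i) //= mulf_eq0 negb_or => /andP[h _].
pose e k : {ffun 'I_n.+1 -> bool} := [ffun l => (s l < k)%N].
have eE k : [ffun l => (x l + e k l)%N] = chain_vertex x s k.
  by apply/ffunP => l; rewrite !ffunE.
case E : (a i (chain_vertex x s i)) h; case E' : (a i (chain_vertex x s i.+1));
  rewrite ?addrr_F2 ?eqxx // => _.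
- by exists (e i.+1), (e i); rewrite !eE.
- by exists (e i), (e i.+1); rewrite !eE.
Qed.

(** * Approximate Brouwer theorem *)

(** An approximate Brouwer theorem on a box. On a fine grid, the label of a node
    in direction t says whether f moves it down or up in that direction; a cell
    carrying both labels in every direction is almost fixed. *)
Lemma brouwer_approx (R : realType) (T : finType) (b : T -> R)
    (f : (T -> R) -> T -> R) :
  let box (v : T -> R) := forall t, 0 <= v t <= b t in
  (forall t, 0 <= b t) ->
  (forall v, box v -> box (f v)) ->
  (forall e : R, 0 < e -> exists2 d : R, 0 < d & forall v w, box v -> box w ->
     (forall t, `|v t - w t| <= d) -> forall t, `|f v t - f w t| <= e) ->
  forall e : R, 0 < e -> exists2 v, box v & forall t, `|f v t - v t| <= e.
Proof.
move=> box b0 fbox fuc e e0.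
have e20 : 0 < e / 2 by rewrite divr_gt0.
have [d d0 fd] := fuc _ e20.
pose m := Num.min d (e / 2).
have m0 : 0 < m by rewrite lt_min d0 divr_gt0.
pose p := (Num.truncn ((\sum_t b t) / m)).+1.
have p0 : 0 < p%:R :> R by rewrite ltr0n.
have mesh t : b t / p%:R <= m.
  rewrite ler_pdivrMr // mulrC -ler_pdivrMr //.
  apply: le_trans (ltW (truncnS_gt _)); rewrite ler_pM2r ?invr_gt0 //.
  by rewrite (bigD1 t) //= lerDl sumr_ge0.
pose v (y : {ffun 'I_#|T| -> nat}) t : R := b t * ((y (enum_rank t))%:R / p%:R).
(* The clauses on y i = 0 and y i = p impose the boundary labels also at the
   nodes outside the box, where nothing is known about f. *)
pose a (i : 'I_#|T|) (y : {ffun 'I_#|T| -> nat}) := (y i != 0%N) &&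
  ((y i == p) || (f (v y) (enum_val i) <= v y (enum_val i))).
have [||x hx] := @cubical_sperner _ p a isT.
- by move=> l y yl; rewrite /a yl.
- by move=> l y yl; rewrite /a yl eqxx.
have vbox (g : {ffun 'I_#|T| -> bool}) : box (v [ffun l => (x l + g l)%N]).
  move=> t; rewrite /v ffunE mulr_ge0 //= ?divr_ge0 //.
  rewrite -[leRHS]mulr1 ler_wpM2l // ler_pdivrMr // mul1r ler_nat.
  by have := ltn_ord (x (enum_rank t)); case: (g _) => /=; lia.
have vnear (g g' : {ffun 'I_#|T| -> bool}) t :
    `|v [ffun l => (x l + g l)%N] t - v [ffun l => (x l + g' l)%N] t| <= m.
  apply: le_trans (mesh t).
  rewrite /v !ffunE -mulrBr -mulrBl !natrD opprD addrACA subrr add0r normrM (ger0_norm (b0 t)).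
  rewrite ler_wpM2l // normrM [X in _ * X]gtr0_norm ?invr_gt0 //.
  rewrite -[leRHS]mul1r ler_pM2r ?invr_gt0 //.
  by case: (g _); case: (g' _); rewrite ?subrr ?subr0 ?sub0r ?normrN ?normr0 ?normr1.
pose z := v [ffun l => (x l + [ffun=> false] l)%N].
have md : m <= d by rewrite ge_min lexx.
have me : m <= e / 2 by rewrite ge_min lexx orbT.
exists z; first exact: vbox.
move=> t; have [g [g' [ag ag']]] := hx (enum_rank t).
set u := v [ffun l => (x l + g l)%N]; set w := v [ffun l => (x l + g' l)%N].
have fu : u t <= f u t.
  move: ag; rewrite /a enum_rankK -/u; case: eqP => [u0 _|_ /=].
    rewrite {1}/u /v u0 mul0r mulr0; by have /andP[] := fbox u (vbox g) t.
  by move/negbT; rewrite negb_or -ltNge => /andP[_ /ltW].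
have fw : f w t <= w t.
  move: ag'; rewrite /a enum_rankK -/w => /andP[_ /orP[/eqP wp|//]].
  rewrite {2}/w /v wp divff ?gt_eqF // mulr1.
  by have /andP[] := fbox w (vbox g') t.
have zu : `|f z t - f u t| <= e / 2.
  by apply: fd => [||s]; [exact: vbox|exact: vbox|exact: le_trans (vnear _ _ s) md].
have zw : `|f z t - f w t| <= e / 2.
  by apply: fd => [||s]; [exact: vbox|exact: vbox|exact: le_trans (vnear _ _ s) md].
have zu' : `|z t - u t| <= m by exact: vnear.
have zw' : `|z t - w t| <= m by exact: vnear.
move: zu zw zu' zw'; rewrite !ler_norml => /andP[? ?] /andP[? ?] /andP[? ?] /andP[? ?].
by apply/andP; split; lra.
Qed.

(** * Continuity in L1 of measure-preserving maps *)

(** The maps phi h preserve the measure and, along the filter F, move little mass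
    of any set of finite measure. This abstract setting is applied below to the
    translations of the line. *)
Section MeasurePreservingL1.
Context d (T : measurableType d) (R : realType).
Variable mu : {measure set T -> \bar R}.
Context (H : Type) (F : set_system H) {FF : Filter F}.
Variable phi : H -> T -> T.
Hypothesis mphi : forall h, measurable_fun setT (phi h).
Hypothesis mu_phi : forall h A, measurable A -> mu (phi h @^-1` A) = mu A.
Hypothesis phi_set : forall A, measurable A -> (mu A < +oo)%E ->
  forall e : R, 0 < e -> \forall h \near F,
  (mu (phi h @^-1` A `\` A) <= e%:E)%E /\ (mu (A `\` phi h @^-1` A) <= e%:E)%E.
Import HBSimple.

Definition L1_continuous (f : T -> R) := forall e : R, 0 < e ->
  \forall h \near F, (\int[mu]_x (`|f (phi h x) - f x|)%:E <= e%:E)%E.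

Lemma ge0_integral_phi (f : T -> \bar R) h : measurable_fun setT f ->
  (forall x, 0 <= f x)%E -> (\int[mu]_x f (phi h x) = \int[mu]_x f x)%E.
Proof.
move=> mf f0.
have := ge0_integral_pushforward (mphi h) mu measurableT mf (fun x _ => f0 x).
rewrite preimage_setT => <-.
by apply: eq_measure_integral => A mA _; exact: mu_phi.
Qed.

Lemma measurable_EFin_dist (f g : T -> R) : measurable_fun setT f ->
  measurable_fun setT g ->
  measurable_fun setT (fun x => (`|f x - g x|)%:E).
Proof.
move=> mf mg; apply/measurable_EFinP; apply: measurableT_comp => //.
exact: measurable_funB.
Qed.

Lemma measurable_phi (f : T -> R) h : measurable_fun setT f ->
  measurable_fun setT (fun x => f (phi h x)).
Proof. by move=> mf; exact: (measurableT_comp mf (mphi h)). Qed.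

Lemma L1_continuousD (f g : T -> R) :
  measurable_fun setT f -> measurable_fun setT g ->
  L1_continuous f -> L1_continuous g -> L1_continuous (fun x => f x + g x).
Proof.
move=> mf mg Tf Tg e e0; have e20 : 0 < e / 2 by rewrite divr_gt0.
apply: filterS2 (Tf _ e20) (Tg _ e20) => h fd gd.
have mF := measurable_EFin_dist (measurable_phi h mf) mf.
have mG := measurable_EFin_dist (measurable_phi h mg) mg.
apply: (@le_trans _ _ (\int[mu]_x ((`|f (phi h x) - f x|)%:E
     + (`|g (phi h x) - g x|)%:E))%E).
  apply: ge0_le_integral => //.
  - have mfg := measurable_funD mf mg.
    exact: (measurable_EFin_dist (measurable_phi h mfg) mfg).
  - exact: emeasurable_funD.
  - move=> x _; rewrite -EFinD lee_fin; apply: le_trans (ler_normD _ _).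
    by rewrite opprD addrACA.
rewrite ge0_integralD //.
by rewrite [e]splitr EFinD leeD.
Qed.

(** The guard on c covers the zero level set of an integrable simple function,
    whose measure may be infinite. *)
Lemma L1_continuous_indic (A : set T) (c : R) : measurable A ->
  (c != 0 -> (mu A < +oo)%E) -> L1_continuous (fun x => c * \1_A x).
Proof.
move=> mA Afin e e0; have [->|c0] := eqVneq c 0.
  apply: nearW => h; rewrite integral0_eq ?lee_fin ?ltW // => x _.
  by rewrite !mul0r subr0 normr0.
pose e' := e / 2 / `|c|.
have e'0 : 0 < e' by rewrite !divr_gt0 ?normr_gt0.
apply: filterS (phi_set mA (Afin c0) e'0) => h [BE CE].
have mAh : measurable (phi h @^-1` A).
  by have := mphi h measurableT mA; rewrite setTI.
move: BE CE; set B := _ `\` A; set C := A `\` _ => BE CE.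
have mB : measurable B by exact: measurableD.
have mC : measurable C by exact: measurableD.
have mc (D : set T) : measurable D ->
    measurable_fun setT (fun x => (`|c|%:E * (\1_D x)%:E)%E).
  move=> mD; rewrite (_ : (fun _ => _) = EFin \o (fun x => `|c| * \1_D x)) //.
  by apply/measurable_EFinP; exact: measurable_funM.
apply: (@le_trans _ _ (\int[mu]_x (`|c|%:E * (\1_B x)%:E + `|c|%:E * (\1_C x)%:E))%E).
  apply: ge0_le_integral => //.
  - have mcA : measurable_fun setT (fun x => c * \1_A x) by exact: measurable_funM.
    exact: (measurable_EFin_dist (measurable_phi h mcA) mcA).
  - by apply: emeasurable_funD; exact: mc.
  - move=> x _; rewrite -!EFinM -EFinD lee_fin -mulrBr normrM -mulrDr ler_wpM2l //.
    rewrite !indicE /B /C !in_setD.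
    have -> : (x \in phi h @^-1` A) = (phi h x \in A) by apply/idP/idP; rewrite !inE.
    by case: (_ \in A); case: (_ \in A);
      rewrite /= ?subrr ?subr0 ?sub0r ?normrN ?normr0 ?normr1 ?addr0 ?add0r.
have c0' (D : set T) x : (0 <= `|c|%:E * (\1_D x)%:E)%E by rewrite -EFinM lee_fin mulr_ge0.
rewrite ge0_integralD //; [|exact: mc|exact: mc].
rewrite !ge0_integralZl_EFin //; do ?[by move=> x _; rewrite lee_fin];
  do ?[by apply/measurable_EFinP; exact: measurable_indic].
rewrite !integral_indic // !setIT.
have -> : e%:E = (`|c|%:E * e'%:E + `|c|%:E * e'%:E)%E.
  by rewrite -!EFinM -EFinD; congr EFin; rewrite /e'; field; rewrite normr_eq0.
by apply: leeD; apply: lee_wpmul2l; rewrite ?lee_fin.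
Qed.

Lemma L1_continuous_sum (I : Type) (r : seq I) (f_ : I -> T -> R) :
  (forall i, measurable_fun setT (f_ i)) -> (forall i, L1_continuous (f_ i)) ->
  L1_continuous (fun x => \sum_(i <- r) f_ i x).
Proof.
move=> mf Tf; elim: r => [|i r IH].
  move=> e e0; apply: nearW => h; rewrite integral0_eq ?lee_fin ?ltW // => x _.
  by rewrite !big_nil subrr normr0.
rewrite (_ : (fun x => _) = (fun x => f_ i x + \sum_(j <- r) f_ j x)).
  by apply: L1_continuousD => //; exact: measurable_sum.
by apply/funext => x; rewrite big_cons.
Qed.

Lemma L1_continuous_sfun (g : {sfun T >-> R}) :
  mu.-integrable setT (EFin \o g) -> L1_continuous g.
Proof.
move=> gi.
have -> : g = (fun x => \sum_(y <- finmap.enum_fset (fset_set (range g)))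
    (y * \1_(g @^-1` [set y]) x)) :> (T -> R).
  by apply/funext => x; rewrite fimfunE fsbig_finite.
apply: L1_continuous_sum => y; first exact: measurable_funM.
apply: L1_continuous_indic => // y0.
have /integrableP[_ gfin] := gi.
suff : (`|y|%:E * mu (g @^-1` [set y]) < +oo)%E.
  by rewrite muleC -lte_pdivlMr ?normr_gt0 // => /lt_le_trans; apply; exact: leey.
apply: le_lt_trans gfin.
rewrite -[X in mu X]setIT -integral_indic // -ge0_integralZl_EFin //; first last.
  exact/measurable_EFinP.
apply: ge0_le_integral => //.
- rewrite (_ : (fun _ => _) = EFin \o (fun x => `|y| * \1_(g @^-1` [set y]) x)) //.
  by apply/measurable_EFinP; exact: measurable_funM.
- by do 2 apply: measurableT_comp => //; exact/measurable_EFinP.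
- move=> x _; rewrite -EFinM lee_fin indicE.
  have [/set_mem /= <-|_] := boolP (x \in _); first by rewrite mulr1.
  by rewrite mulr0.
Qed.

(** By density of simple functions: phi h is an isometry of L1, so the error of
    the approximation is counted twice, uniformly in h. *)
Theorem integrable_L1_continuous (f : T -> R) :
  mu.-integrable setT (EFin \o f) -> L1_continuous f.
Proof.
move=> fi e e0; have e30 : 0 < e / 3 by rewrite divr_gt0.
have mf : measurable_fun setT f by apply/measurable_EFinP; case/integrableP: fi.
have [g_ [gi _ g_f]] := approximation_sfun_integrable measurableT fi.
have [n fg] : exists n, (\int[mu]_x (`|f x - g_ n x|)%:E <= (e / 3)%:E)%E.
  have /fine_cvgP[fin] := g_f.
  move=> /cvgrPdist_le /(_ _ e30) gle.
  near \oo => n; exists n.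
  have finn : (\int[mu]_x `|f x - (g_ n x)|%:E)%E \is a fin_num by near: n.
  rewrite -(fineK finn) lee_fin.
  have : `|0 - fine (\int[mu]_x `|f x - (g_ n x)|%:E)%E| <= e / 3 by near: n.
  by rewrite sub0r normrN; apply: le_trans; exact: ler_norm.
have mg : measurable_fun setT (g_ n) by [].
apply: filterS (L1_continuous_sfun (gi n) e30) => h gh.
have mfh := measurable_phi h mf; have mgh := measurable_phi h mg.
have m1 := measurable_EFin_dist mfh mgh.
have m2 := measurable_EFin_dist mgh mg.
have m3 := measurable_EFin_dist mf mg.
apply: (@le_trans _ _ (\int[mu]_x ((`|f (phi h x) - g_ n (phi h x)|)%:E
     + ((`|g_ n (phi h x) - g_ n x|)%:E + (`|f x - g_ n x|)%:E)))%E).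
  apply: ge0_le_integral => //.
  - exact: measurable_EFin_dist.
  - by apply: emeasurable_funD => //; exact: emeasurable_funD.
  - move=> x _; rewrite -!EFinD lee_fin [`|f x - _|]distrC.
    by apply: le_trans (ler_distD (g_ n (phi h x)) _ _) _; rewrite lerD2l ler_distD.
rewrite ge0_integralD //; [|by move=> x _; rewrite adde_ge0|exact: emeasurable_funD].
rewrite ge0_integralD //.
rewrite (@ge0_integral_phi (fun x => (`|f x - g_ n x|)%:E)) //.
have -> : e%:E = ((e / 3)%:E + ((e / 3)%:E + (e / 3)%:E))%E.
  by rewrite -!EFinD; congr EFin; field.
by rewrite !leeD.
Unshelve. all: by end_near. Qed.
End MeasurePreservingL1.

(** * Translations of the completed Lebesgue measure *)

Section Translation.
Variable R : realType.
Local Notation cmu := (@completed_lebesgue_measure R).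
Local Notation cR := (caratheodory_type ((wlength (@idfun R))^*)%mu).
Implicit Types (A : set R) (h : R).

(** The completed measure is the outer measure generated by the lengths of the
    half-open intervals, so the invariance holds for arbitrary sets: translating
    a cover by intervals does not change its total length. *)
Lemma completed_lebesgue_measure_translate A h :
  cmu [set x : R | A (x + h)] = cmu A.
Proof.
have le (B : set R) (t : R) : (cmu [set x : R | B (x + t)%R] <= cmu B)%E.
  apply: le_ereal_inf_tmp => _ /= [F [Foc BF] <-].
  pose G k := [set x : R | F k (x + t)].
  have Fab k : exists ab : R * R, ab.1 <= ab.2 /\ F k = `]ab.1, ab.2]%classic.
    have /ocitvP[->|[ab lt ->]] : ocitv (F k) by exact: Foc.
      by exists (0, 0); rewrite set_itvoc0.
    by exists ab; rewrite ltW.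
  have GE k (ab : R * R) : F k = `]ab.1, ab.2]%classic ->
      G k = `]ab.1 - t, ab.2 - t]%classic.
    move=> FE; apply/seteqP; split=> x; rewrite /G /= FE /= !in_itv /=;
    by rewrite ltrBlDr lerBrDr.
  rewrite -[leRHS](_ : \sum_(k <oo) wlength idfun (G k) = _)%E; last first.
    apply: eq_eseriesr => k _; have [ab [ab12 FE]] := Fab k.
    rewrite (GE _ _ FE) FE !wlength_itv_bnd ?lerD2r //.
    by congr (_%:E); rewrite /=; ring.
  apply: ereal_inf_lbound => /=; exists G => //; split.
    by move=> k; have [ab [_ FE]] := Fab k; rewrite (GE _ _ FE); exact: is_ocitv.
  by move=> x /= /BF [k _ Fk]; exists k.
apply/eqP; rewrite eq_le le /=.
rewrite -[in leLHS](_ : [set x : R | [set y : R | A (y + h)] (x + - h)] = A) ?le //.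
by apply/seteqP; split => x /=; rewrite subrK.
Qed.

(** Measurability is the splitting condition of Caratheodory, which only refers
    to the translation invariant outer measure. *)
Lemma measurable_translate h :
  measurable_fun [set: cR] ((fun x : R => x + h) : cR -> cR).
Proof.
move=> _ A mA; rewrite setTI.
have mA' : forall X : set R, (cmu X = cmu (X `&` A) + cmu (X `&` ~` A))%E := mA.
suff H : forall X : set R, (cmu X = cmu (X `&` [set x : R | A (x + h)%R])
    + cmu (X `&` ~` [set x : R | A (x + h)%R]))%E by exact: H.
move=> X; rewrite -(completed_lebesgue_measure_translate X (- h)) mA'.
congr (_ + _)%E.
  rewrite -[LHS](completed_lebesgue_measure_translate _ h); congr cmu.
  by apply/seteqP; split => x /=; rewrite addrK.
rewrite -[LHS](completed_lebesgue_measure_translate _ h); congr cmu.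
by apply/seteqP; split => x /=; rewrite addrK.
Qed.

Lemma ge0_integral_translate (f : cR -> \bar R) h :
  measurable_fun [set: cR] f -> (forall x, 0 <= f x)%E ->
  (\int[cmu]_x f ((x : R) + h)%R = \int[cmu]_x f x)%E.
Proof.
move=> mf f0.
exact: (@ge0_integral_phi _ cR R cmu R _ measurable_translate
  (fun t A _ => completed_lebesgue_measure_translate A t) f h mf f0).
Qed.

Lemma integrable_translate (f : cR -> \bar R) h :
  cmu.-integrable setT f -> cmu.-integrable setT (fun x => f ((x : R) + h)%R).
Proof.
move=> /integrableP[mf fi]; apply/integrableP; split.
  exact: (measurableT_comp mf (measurable_translate h)).
have mabs : measurable_fun [set: cR] (fun x => `|f x|%E) by exact: measurableT_comp.
have e := @ge0_integral_translate (fun x => `|f x|%E) h mabs (fun x => abse_ge0 _).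
apply: le_lt_trans fi; rewrite -e; exact: lexx.
Qed.

Lemma measurable_completed (f : R -> R) : continuous f ->
  measurable_fun [set: cR] (f : cR -> R).
Proof.
move=> cf _ B mB; rewrite setTI.
apply: sub_caratheodory.
by have := continuous_measurable_fun cf measurableT mB; rewrite setTI.
Qed.

Lemma compact_translate_subset (V U : set R) : compact V -> open U -> V `<=` U ->
  exists2 d : R, 0 < d & forall h, `|h| < d -> forall x, V x -> U (x + h).
Proof.
move=> cV oU VU.
have : \forall h \near (0 : R), V `<=` (fun x => U (x + h)).
  have /compact_near_coveringP nc := cV.
  apply: (nc R (nbhs (0 : R)) (fun h x => U (x + h))) => x Vx.
  have : (fun z : R * R => z.1 + z.2) @ (nbhs x, nbhs (0 : R)) --> x + 0.
    exact: add_continuous (x, 0).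
  rewrite addr0; apply; apply: open_nbhs_nbhs; split => //; exact: VU.
move=> /nbhs_ballP[d /= d0 dV]; exists d => // h hd x Vx.
by apply: dV => //; rewrite /ball /= sub0r normrN.
Qed.

(** Squeeze a compact V inside A and an open U around V, up to small measure: a
    small translation keeps V inside U. *)
Lemma translate_setD_small (A : set cR) (e : R) : measurable A ->
  (cmu A < +oo)%E -> 0 < e ->
  exists2 d : R, 0 < d & forall h, `|h| < d ->
    (cmu ([set x : R | A (x + h)%R] `\` A) <= e%:E)%E.
Proof.
move=> mA Afin e0; pose e2 := e / 2.
have e20 : 0 < e2 by rewrite divr_gt0.
have [X mX [N negN XN]] : completed_algebra_gen (@lebesgue_measure R) A.
  by rewrite -g_sigma_completed_algebra_genE completed_caratheodory_measurable.
have N0 : cmu N = 0%E by apply/(negligible_outer_measure N).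
have Xfin : (lebesgue_measure X < +oo)%E.
  apply: le_lt_trans Afin; apply: le_outer_measure.
  by rewrite -XN; exact: subsetUl.
have [V [cV VX XV]] := lebesgue_regularity_inner mX Xfin e20.
have mV : measurable (V : set (measurableTypeR R)).
  by apply: closed_measurable; apply: compact_closed => //; exact: Rhausdorff.
have Vfin : (lebesgue_measure V < +oo)%E.
  by apply: le_lt_trans Xfin; apply: le_outer_measure.
have [U [oU VU UV]] := lebesgue_regularity_outer mV Vfin e20.
have [d d0 dU] := compact_translate_subset cV oU VU.
exists d => // h hd.
have AV : (cmu (A `\` V) <= e2%:E)%E.
  apply: (@le_trans _ _ (cmu (X `\` V) + cmu N)%E); last by rewrite N0 adde0 ltW.
  apply: le_trans (outer_measureU2 _ _ _); apply: le_outer_measure.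
  by rewrite -XN => x [[Xx|Nx] Vx]; [left|right].
apply: (@le_trans _ _ (cmu [set x : R | (A `\` V) (x + h)%R] + cmu (U `\` V))%E).
  apply: le_trans (outer_measureU2 _ _ _); apply: le_outer_measure.
  move=> x [/= Axh Ax]; have [Vxh|Vxh] := pselect (V (x + h)).
    right; split.
      by rewrite -[x](addrK h); apply: dU => //; rewrite normrN.
    by move=> /VX Xx; apply: Ax; rewrite -XN; left.
  by left.
rewrite completed_lebesgue_measure_translate [e]splitr EFinD leeD //.
exact: ltW.
Qed.

Lemma integrable_translation_continuous (f : cR -> R) :
  cmu.-integrable setT (EFin \o f) ->
  forall e : R, 0 < e -> exists2 r : R, 0 < r & forall h, `|h| < r ->
    (\int[cmu]_x (`|f ((x : R) + h)%R - f x|)%:E <= e%:E)%E.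
Proof.
move=> fi e e0.
pose phi (h : R) : cR -> cR := fun x : R => x + h.
have phi_set (A : set cR) : measurable A -> (cmu A < +oo)%E -> forall r : R, 0 < r ->
    \forall h \near (0 : R), (cmu (phi h @^-1` A `\` A) <= r%:E)%E /\
      (cmu (A `\` phi h @^-1` A) <= r%:E)%E.
  move=> mA Afin r r0; have [s s0 sP] := translate_setD_small mA Afin r0.
  apply/nbhs_ballP; exists s => // h; rewrite /ball /= sub0r normrN => hs.
  split; first exact: sP.
  rewrite -(completed_lebesgue_measure_translate _ (- h)).
  rewrite (_ : [set x : R | _] = [set x : R | A (x + - h)] `\` A); last first.
    by apply/seteqP; split => x; rewrite /phi /= subrK.
  by apply: sP; rewrite normrN.
have muphi h (A : set cR) : measurable A -> cmu (phi h @^-1` A) = cmu A.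
  by move=> _; exact: completed_lebesgue_measure_translate.
have N : nbhs (0 : R) (fun h : R => (\int[cmu]_x (`|f ((x : R) + h)%R - f x|)%:E <= e%:E)%E) :=
  @integrable_L1_continuous _ cR R cmu R (nbhs (0 : R)) (nbhs_filter (0 : R)) phi
  measurable_translate muphi phi_set f fi e e0.
have [r /= r0 rP] := proj1 (nbhs_ballP (0 : R) _) N; exists r => // h hr.
by apply: rP; rewrite /ball /= sub0r normrN.
Qed.
End Translation.

(** * Weighted integrals *)

Section WeightedIntegral.
Context d (T : measurableType d) (R : realType).
Variable mu : {measure set T -> \bar R}.
Implicit Types (h k : T -> R) (B r : R).

Lemma integrable_bounded_mul h k B : measurable_fun setT h ->
  (forall x, `|h x| <= B) -> mu.-integrable setT (EFin \o k) ->
  mu.-integrable setT (fun x => (h x * k x)%:E).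
Proof.
move=> mh hB ki.
rewrite (_ : (fun x => _) = (EFin \o h) \* (EFin \o k))%E; last first.
  by apply/funext => x.
apply: integrableMr => //; exists B; split; first exact: num_real.
by move=> y By x _; apply: le_trans (hB x) (ltW By).
Qed.

Lemma integrable_distB k k' :
  mu.-integrable setT (EFin \o k) -> mu.-integrable setT (EFin \o k') ->
  mu.-integrable setT (fun x => (`|k x - k' x|)%:E).
Proof.
move=> ki k'i; have kki := integrableB measurableT ki k'i.
exact: (@integrable_norm _ _ _ mu setT (fun x => k x - k' x)).
Qed.

Lemma Rintegral_mul_weight_dist h k k' B : measurable_fun setT h ->
  (forall x, `|h x| <= B) -> mu.-integrable setT (EFin \o k) ->
  mu.-integrable setT (EFin \o k') ->
  `|\int[mu]_x (h x * k x) - \int[mu]_x (h x * k' x)| <=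
    B * \int[mu]_x `|k x - k' x|.
Proof.
move=> mh hB ki k'i.
have hki := integrable_bounded_mul mh hB ki.
have hk'i := integrable_bounded_mul mh hB k'i.
rewrite -RintegralB //.
have hBi := integrableB measurableT hki hk'i.
apply: le_trans (le_normr_Rintegral _ hBi) _ => //.
have kk' := integrable_distB ki k'i.
rewrite -RintegralZl //; apply: le_Rintegral => //.
- exact: (@integrable_norm _ _ _ mu setT (fun x => h x * k x - h x * k' x)).
- exact: (integrableZl measurableT B kk').
- by move=> x _; rewrite -mulrBr normrM ler_wpM2r.
Qed.

Lemma Rintegral_mul_fun_dist h h' k B r : measurable_fun setT h ->
  measurable_fun setT h' -> (forall x, `|h x| <= B) -> (forall x, `|h' x| <= B) ->
  mu.-integrable setT (EFin \o k) -> (forall x, 0 <= k x) ->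
  (forall x, `|h x - h' x| <= r) ->
  `|\int[mu]_x (h x * k x) - \int[mu]_x (h' x * k x)| <= r * \int[mu]_x k x.
Proof.
move=> mh mh' hB h'B ki k0 hr.
have hki := integrable_bounded_mul mh hB ki.
have h'ki := integrable_bounded_mul mh' h'B ki.
rewrite -RintegralB //.
have hBi := integrableB measurableT hki h'ki.
apply: le_trans (le_normr_Rintegral _ hBi) _ => //.
rewrite -RintegralZl //; apply: le_Rintegral => //.
- exact: (@integrable_norm _ _ _ mu setT (fun x => h x * k x - h' x * k x)).
- exact: (integrableZl measurableT r ki).
- by move=> x _; rewrite -mulrBl normrM (ger0_norm (k0 x)) ler_wpM2r.
Qed.

Lemma cvg_Rintegral_mul (h_ : nat -> T -> R) h k B :
  (forall n, measurable_fun setT (h_ n)) -> measurable_fun setT h ->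
  (forall n x, `|h_ n x| <= B) ->
  mu.-integrable setT (EFin \o k) ->
  (forall x, h_ n x @[n --> \oo] --> h x) ->
  \int[mu]_x (h_ n x * k x) @[n --> \oo] --> \int[mu]_x (h x * k x).
Proof.
move=> mh_ mh hB ki hcvg.
have mk : measurable_fun setT k by apply/measurable_EFinP; case/integrableP: ki.
have Bk : mu.-integrable setT (fun x => (`|B| * `|k x|)%:E).
  have nk := @integrable_norm _ _ _ mu setT k ki.
  exact: (integrableZl measurableT `|B| nk).
have [||||hki _ Hc] := @dominated_convergence _ T R mu setT measurableT
   (fun n x => (h_ n x * k x)%:E) (fun x => (h x * k x)%:E) (fun x => (`|B| * `|k x|)%:E) _ _ _ Bk _.
- by move=> n; apply/measurable_EFinP; exact: measurable_funM.
- by apply/measurable_EFinP; exact: measurable_funM.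
- apply: aeW => x _; apply: cvg_EFin; first exact: nearW.
  apply: cvgMl; exact: hcvg.
- apply: aeW => x n _; rewrite abse_EFin lee_fin normrM ler_wpM2r //.
  by apply: le_trans (hB n x) (ler_norm B).
rewrite /Rintegral.
by apply: fine_cvg; rewrite fineK //; exact: integrable_fin_num.
Qed.
End WeightedIntegral.

(** * A fixed point theorem between two barriers *)

Section ClusterPoint.
Import ArrowAsProduct.

(** Compactness of a product of segments. The index set may be uncountable, so
    no subsequence is claimed: g is approximated along finite sets of indices. *)
Lemma pointwise_cluster_point (R : realType) (T : eqType) (b : T -> R)
    (u : nat -> T -> R) : (forall n t, 0 <= u n t <= b t) ->
  exists g : T -> R, forall (s : seq T) (e : R) (j : nat), 0 < e ->
    exists2 n, (j <= n)%N & forall t, t \in s -> `|u n t - g t| <= e.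
Proof.
move=> ub.
have cA := @tychonoff T (fun _ => R) (fun t => `[0, b t]%classic)
  (fun t => @segment_compact R 0 (b t)).
have [|g [_ gcl]] := cA (u @ \oo) _.
  by exists 0%N => // n _ t; rewrite /= in_itv /= ub.
exists g => s e j e0.
have nB : nbhs g [set f : T -> R | forall t, t \in s -> `|f t - g t| <= e].
  elim: s => [|t s IH]; first by apply: filterS filterT => f _ t.
  have /= pt := @proj_continuous T (fun _ => R) t g.
  have nt : nbhs (g t) [set y : R | `|y - g t| <= e].
    apply/nbhs_ballP; exists e => // y; rewrite /ball /= distrC; exact: ltW.
  apply: filterS2 IH (pt _ nt) => f fs ft t'.
  by rewrite inE => /orP[/eqP ->|]; [exact: ft|exact: fs].
have FA : (u @ \oo) [set f | exists2 n, (j <= n)%N & f = u n].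
  by exists j => // n /= jn; exists n.
have [f [[n jn ->] fB]] := gcl _ _ FA nB.
by exists n.
Qed.
End ClusterPoint.

Lemma unif_continuous_realP (R : realType) (f : R -> R) :
  unif_continuous f <-> forall e : R, 0 < e -> exists2 d : R, 0 < d &
    forall x y : R, `|x - y| < d -> `|f x - f y| < e.
Proof.
rewrite unif_continuousP; split=> H e e0; have [d d0 fd] := H e e0; exists d => //.
  by move=> x y xy; exact: (fd (x, y)).
by move=> [x y]; exact: fd.
Qed.

Lemma dense_sequence (R : realType) :
  exists q : nat -> R, forall x d : R, 0 < d -> exists p, `|x - q p| < d.
Proof.
exists (fun p => if unpickle p is Some r then ratr r else 0) => x d d0.
have [r] := @rat_in_itvoo R (x - d) (x + d) ltac:(lra).
rewrite in_itv /= => /andP[r1 r2]; exists (pickle r); rewrite pickleK.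
by rewrite ltr_norml; apply/andP; split; lra.
Qed.

(** A theorem of Schauder type. The pseudometrics d replace a modulus of
    continuity common to all the values of F. *)
Section FixedPoint.
Variables (R : realType) (m : nat).
Local Notation field := ('I_m -> R -> R).
Variables (lo up : field) (M : 'I_m -> R) (d : 'I_m -> R -> R -> R).
Variable F : field -> field.

Definition between (Phi : field) :=
  (forall l, unif_continuous (Phi l)) /\ forall l x, lo l x <= Phi l x <= up l x.

Hypothesis lo_uc : forall l, unif_continuous (lo l).
Hypothesis up_uc : forall l, unif_continuous (up l).
Hypothesis lo_ge0 : forall l x, 0 <= lo l x.
Hypothesis lo_le_up : forall l x, lo l x <= up l x.
Hypothesis up_leM : forall l x, up l x <= M l.
Hypothesis d_ge0 : forall l x y, 0 <= d l x y.
Hypothesis d_sym : forall l x y, d l x y = d l y x.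
Hypothesis d_tri : forall l x y z, d l x z <= d l x y + d l y z.
Hypothesis d_small : forall l (e : R), 0 < e -> exists2 r : R, 0 < r &
  forall x y, `|x - y| < r -> d l x y <= e.
Hypothesis F_between : forall Phi, between Phi ->
  forall l x, lo l x <= F Phi l x <= up l x.
Hypothesis F_lip : forall Phi, between Phi ->
  forall l x y, `|F Phi l x - F Phi l y| <= d l x y.
Variable K : R.
Hypothesis F_sup : forall Phi Psi r, between Phi -> between Psi -> 0 <= r ->
  (forall l x, `|Phi l x - Psi l x| <= r) ->
  forall l x, `|F Phi l x - F Psi l x| <= K * r.
Hypothesis F_cvg : forall (Phi_ : nat -> field) Phi,
  (forall n, between (Phi_ n)) -> between Phi ->
  (forall l x, Phi_ n l x @[n --> \oo] --> Phi l x) ->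
  forall l x, F (Phi_ n) l x @[n --> \oo] --> F Phi l x.

Lemma d_lip_unif_continuous l (f : R -> R) :
  (forall x y, `|f x - f y| <= d l x y) -> unif_continuous f.
Proof.
move=> fd; apply/unif_continuous_realP => e e0.
have [|r r0 dr] := @d_small l (e / 2); first by rewrite divr_gt0.
by exists r => // x y xy; apply: le_lt_trans (fd x y) _; have := dr x y xy; lra.
Qed.

Section Interpolation.
Variables (n : nat) (q : 'I_n -> R).
Local Notation node := ('I_m * 'I_n)%type.

(** The largest function bounded by M l and 1-Lipschitz for d l whose values at
    the nodes are at most v (McShane). *)
Definition lower_envelope (v : node -> R) (l : 'I_m) (x : R) : R :=
  \big[Num.min/M l]_(p < n) (v (l, p) + d l x (q p)).

Definition interpolant (v : node -> R) : field := fun l x =>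
  Num.max (lo l x) (Num.min (up l x) (lower_envelope v l x)).

(** Covers both a change of the point and a change of the prescribed values. *)
Lemma lower_envelopeB v w l x y r : 0 <= r ->
  (forall p, v (l, p) + d l x (q p) <= w (l, p) + d l y (q p) + r) ->
  lower_envelope v l x <= lower_envelope w l y + r.
Proof.
move=> r0 H; rewrite -lerBlDr; apply: le_bigmin => [|p _].
  by rewrite lerBlDr (le_trans (bigmin_le_id _ _ _ _)) // lerDl.
by rewrite lerBlDr; apply: bigmin_inf (H p).
Qed.

Lemma lower_envelope_lip v l x y :
  `|lower_envelope v l x - lower_envelope v l y| <= d l x y.
Proof.
rewrite ler_distl lerBlDr; apply/andP; split; apply: lower_envelopeB => // p.
  by have := d_tri l y x (q p); rewrite (d_sym l y x); lra.
by have := d_tri l x y (q p); lra.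
Qed.

Lemma max_dist (a a' b b' r : R) : `|a - a'| <= r -> `|b - b'| <= r ->
  `|Num.max a b - Num.max a' b'| <= r.
Proof.
rewrite /Num.max !ler_norml => /andP[? ?] /andP[? ?].
by case: ifPn; case: ifPn; rewrite -?leNgt => *; apply/andP; split; lra.
Qed.

Lemma min_dist (a a' b b' r : R) : `|a - a'| <= r -> `|b - b'| <= r ->
  `|Num.min a b - Num.min a' b'| <= r.
Proof.
rewrite /Num.min !ler_norml => /andP[? ?] /andP[? ?].
by case: ifPn; case: ifPn; rewrite -?leNgt => *; apply/andP; split; lra.
Qed.

Lemma interpolant_between v : between (interpolant v).
Proof.
split=> [l|l x]; last first.
  rewrite /interpolant le_max lexx /= ge_max lo_le_up /= ge_min lexx //.
apply/unif_continuous_realP => e e0.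
have e20 : 0 < e / 2 by rewrite divr_gt0.
have [a a0 aP] := proj1 (unif_continuous_realP _) (lo_uc l) _ e20.
have [b b0 bP] := proj1 (unif_continuous_realP _) (up_uc l) _ e20.
have [c c0 cP] := proj1 (unif_continuous_realP _)
  (d_lip_unif_continuous (lower_envelope_lip v l)) _ e20.
exists (Num.min a (Num.min b c)); first by rewrite !lt_min a0 b0.
move=> x y; rewrite !lt_min => /and3P[/aP /ltW xa /bP /ltW xb /cP /ltW xc].
apply: (@le_lt_trans _ _ (e / 2)); last by lra.
by apply: max_dist => //; exact: min_dist.
Qed.

Lemma interpolant_dist v w r : 0 <= r -> (forall t, `|v t - w t| <= r) ->
  forall l x, `|interpolant v l x - interpolant w l x| <= r.
Proof.
move=> r0 vw l x; apply: max_dist; rewrite ?subrr ?normr0 //.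
apply: min_dist; rewrite ?subrr ?normr0 //.
rewrite ler_distl lerBlDr; apply/andP; split; apply: lower_envelopeB => // p.
  by have := vw (l, p); rewrite ler_norml => /andP[? ?]; lra.
by have := vw (l, p); rewrite ler_norml => /andP[? ?]; lra.
Qed.

(** Brouwer applied to the values at the nodes. When v is almost the restriction
    of g = F (interpolant v) to the nodes, the envelope of v lies within
    2 d(x, q p) + e of g, as both are 1-Lipschitz; truncating it between lo and up
    moves it no further from g, which already lies there. *)
Lemma approx_fixed_point (e : R) : 0 < e -> exists Phi, between Phi /\
  forall l x p, `|Phi l x - F Phi l x| <= d l x (q p) *+ 2 + e.
Proof.
move=> e0; have M0 l : 0 <= M l.
  by apply: le_trans (lo_ge0 l 0) _; apply: le_trans (up_leM l 0).
have box Phi : between Phi -> forall l x, 0 <= F Phi l x <= M l.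
  move=> bP l x; have /andP[h1 h2] := F_between bP l x.
  by rewrite (le_trans (lo_ge0 l x)) //= (le_trans h2).
pose f v (t : node) := F (interpolant v) t.1 (q t.2).
have [||v vb vf] := @brouwer_approx R node (fun t => M t.1) f (fun t => M0 t.1) _ _ e e0.
- by move=> v _ t; apply: box; exact: interpolant_between.
- move=> r r0; exists (r / (`|K| + 1)); first by rewrite divr_gt0 // ltr_wpDl.
  move=> v w _ _ vw t.
  have K1 : 0 < `|K| + 1 by rewrite ltr_wpDl.
  have s0 : 0 <= r / (`|K| + 1) by rewrite divr_ge0 // ltW.
  apply: le_trans (F_sup (interpolant_between v) (interpolant_between w) s0 _ _ _) _.
    exact: interpolant_dist.
  apply: (@le_trans _ _ ((`|K| + 1) * (r / (`|K| + 1)))).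
    by rewrite ler_wpM2r //; have := ler_norm K; lra.
  by rewrite mulrC divfK // gt_eqF.
exists (interpolant v); split; first exact: interpolant_between.
move=> l x p; set g := F _ _; have bI := interpolant_between v.
have gl y : `|g x - g y| <= d l x y by exact: F_lip.
have /andP[g1 g2] := F_between bI l x.
have /andP[_ gM] := box _ bI l x; rewrite -/g in g1 g2 gM.
have u1 : lower_envelope v l x <= g x + (d l x (q p) *+ 2 + e).
  apply: bigmin_inf (_ : v (l, p) + d l x (q p) <= _) => //.
  have := vf (l, p); have := gl (q p); rewrite /f /= -/g !ler_norml.
  by move=> /andP[? ?] /andP[? ?]; rewrite mulr2n; lra.
have u2 : g x - e <= lower_envelope v l x.
  apply: le_bigmin => [|p' _]; first by lra.
  have := vf (l, p'); have := gl (q p'); rewrite /f /= -/g !ler_norml.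
  by move=> /andP[? ?] /andP[? ?]; lra.
have d0 := d_ge0 l x (q p).
have -> : g x = Num.max (lo l x) (Num.min (up l x) (g x)).
  by rewrite (min_idPr g2) (max_idPr g1).
have r0 : 0 <= d l x (q p) *+ 2 + e by rewrite addr_ge0 ?mulrn_wge0 // ltW.
apply: max_dist; rewrite ?subrr ?normr0 //.
apply: min_dist; rewrite ?subrr ?normr0 //.
by move: u1; rewrite ler_norml mulr2n => u1; apply/andP; split; lra.
Qed.
End Interpolation.

Lemma invn_small (e : R) : 0 < e -> exists N, forall n, (N <= n)%N -> n.+1%:R^-1 < e.
Proof.
by move=> e0; have [N _ HN] := near_infty_natSinv_lt (PosNum e0); exists N => n /HN.
Qed.

(** The images of the approximate fixed points cluster at some g on finite sets
    of points. As all of them are 1-Lipschitz for d, a diagonal sequence that is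
    good on a dense sequence converges everywhere; the approximate fixed points
    then converge to the same limit, and continuity of F concludes. *)
Theorem fixed_point_between :
  exists Phi, between Phi /\ forall l x, Phi l x = F Phi l x.
Proof.
have [q qP] := dense_sequence R.
have /choice[Phi_ PhiP] : forall n : nat, exists Phi, between Phi /\
    forall l x (p : 'I_n), `|Phi l x - F Phi l x| <= d l x (q p) *+ 2 + n.+1%:R^-1.
  by move=> n; apply: (@approx_fixed_point n (fun p => q p)); rewrite invr_gt0.
have bPhi n : between (Phi_ n) by case: (PhiP n).
pose u n (t : 'I_m * R) := F (Phi_ n) t.1 t.2.
have ub n t : 0 <= u n t <= M t.1.
  have /andP[h1 h2] := F_between (bPhi n) t.1 t.2.
  by rewrite (le_trans (lo_ge0 _ _) h1) /= (le_trans h2).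
have [g gP] := pointwise_cluster_point ub.
have g_lip l x y : `|g (l, x) - g (l, y)| <= d l x y.
  apply/ler_addgt0Pr => e e0.
  have [|n _ ngP] := gP [:: (l, x); (l, y)] (e / 2) 0%N; first by rewrite divr_gt0.
  have := ngP (l, x); have := ngP (l, y); have := F_lip (bPhi n) l x y.
  rewrite !inE !eqxx orbT /= !ler_norml /u /= => /andP[? ?].
  by move=> /(_ isT) /andP[? ?] /(_ isT) /andP[? ?]; apply/andP; split; lra.
have g_between l x : lo l x <= g (l, x) <= up l x.
  apply/andP; split; apply/ler_addgt0Pr => e e0;
    have [n _ /(_ (l, x))] := gP [:: (l, x)] e 0%N e0;
    have /andP[? ?] := F_between (bPhi n) l x;
    by rewrite inE eqxx /u /= ler_norml => /(_ isT) /andP[? ?]; lra.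
pose G : field := fun l x => g (l, x).
have bG : between G.
  by split=> // l; apply: (@d_lip_unif_continuous l) => x y; exact: g_lip.
have /choice[s sP] : forall j : nat, exists n, (j <= n)%N /\
    forall l p, (p < j)%N -> `|u n (l, q p) - g (l, q p)| <= j.+1%:R^-1.
  move=> j; have j0 : (0 : R) < j.+1%:R^-1 by rewrite invr_gt0.
  have [n jn nP] := gP [seq (l, q p) | l <- enum 'I_m, p <- iota 0 j] _ j j0.
  exists n; split=> // l p pj; apply: nP; apply: allpairs_f.
    by rewrite mem_enum.
  by rewrite mem_iota.
have uG l x : u (s j) (l, x) @[j --> \oo] --> G l x.
  apply/cvgrPdist_lt => e e0.
  have e40 : 0 < e / 4 by rewrite divr_gt0.
  have [r r0 rP] := d_small l e40; have [p xp] := qP x r r0.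
  have dp := rP _ _ xp; have [N NP] := invn_small e40.
  exists (maxn N p.+1) => // j /=; rewrite geq_max => /andP[Nj pj].
  have [_ /(_ l p pj)] := sP j; have := NP j Nj.
  have := F_lip (bPhi (s j)) l x (q p); have := g_lip l x (q p).
  rewrite /u /G /= !ler_norml !ltr_norml; move: (j.+1%:R^-1) => z.
  by move=> /andP[? ?] /andP[? ?] ? /andP[? ?]; apply/andP; split; lra.
have PhiG l x : Phi_ (s j) l x @[j --> \oo] --> G l x.
  apply/cvgrPdist_lt => e e0.
  have e60 : 0 < e / 6 by rewrite divr_gt0.
  have [r r0 rP] := d_small l e60; have [p xp] := qP x r r0.
  have dp := rP _ _ xp; have [N NP] := invn_small e60.
  have /cvgrPdist_lt/(_ _ e60)[N' _ N'P] := uG l x.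
  exists (maxn N' (maxn N p.+1)) => // j /=; rewrite !geq_max => /and3P[N'j Nj pj].
  have [js _] := sP j; have ps : (p < s j)%N by apply: leq_trans js.
  have [_ /(_ l x (Ordinal ps))] := PhiP (s j).
  have := NP (s j) (leq_trans Nj js); have := N'P j N'j; rewrite /u /=.
  rewrite mulr2n !ler_norml !ltr_norml; move: ((s j).+1%:R^-1) => z.
  by move=> /andP[? ?] ? /andP[? ?]; apply/andP; split; lra.
exists G; split=> // l x.
have FG := @F_cvg (fun j => Phi_ (s j)) G (fun j => bPhi (s j)) bG PhiG l x.
by rewrite -(cvg_lim (@Rhausdorff R) (uG l x)) (cvg_lim (@Rhausdorff R) FG).
Qed.
End FixedPoint.

(** * Vector-valued functions *)

Section RowFunctions.
Variables (R : realType) (m : nat).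

Lemma unif_continuous_rowP (U : R -> 'rV[R]_m) :
  unif_continuous U <-> forall l, unif_continuous (fun x => U x 0 l).
Proof.
split=> [/unif_continuousP H l|H].
  apply/unif_continuousP => e e0; have [d d0 dP] := H e e0.
  by exists d => // x /dP [_]; exact.
apply/unif_continuousP => e e0.
have : \forall d \near (0 : R)^'+, forall l x, ball x.1 d x.2 ->
    ball (U x.1 0 l) e (U x.2 0 l).
  apply: filter_forall => l.
  have /unif_continuousP/(_ e e0)[d d0 dP] := H l.
  near=> d' => x xd'; apply: dP; apply: le_ball xd'.
  by near: d'; exact: nbhs_right_le.
move=> nd; have [d [dP d0]] := filter_ex (filterI nd (nbhs_right_gt (0 : R))).
by exists d => // x xd; split=> // i l; rewrite !ord1; exact: dP.
Unshelve. all: by end_near. Qed.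

Lemma bounded_fun_row (U : R -> 'rV[R]_m) (B : 'rV[R]_m) :
  (forall x l, 0 <= U x 0 l <= B 0 l) -> bounded_fun U.
Proof.
move=> UB; exists `|B|; split; first exact: num_real.
move=> r Br x _ /=; apply: le_trans (ltW Br).
rewrite [`|B|]mx_normrE [leLHS]mx_normrE; apply: bigmax_le => [|[i l] _ /=].
  exact: bigmax_ge_id.
rewrite (ord1 i); have /andP[U0 UBl] := UB x l.
rewrite ger0_norm //; apply: le_trans UBl _.
by apply: le_trans (ler_norm _) _; apply: (le_bigmax _ (fun ij => `|B ij.1 ij.2|) (0, l)).
Qed.
End RowFunctions.

(** * The nonlinearity and the kernels *)

Section ProfileOperator.
Variables (R : realType) (m tau : nat) (P : 'I_m -> 'M[R]_(m, tau) -> R).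
Variables (M E : 'rV[R]_m) (c : R).
Hypothesis hP : growth_assumptions P M E.
Local Notation field := ('I_m -> R -> R).
Local Notation history := (fun Phi : field => delayed_args c (fun l (_ : 'I_tau) => Phi l)).

Lemma growth_M_ge0 l : 0 <= M 0 l.
Proof.
apply: le_trans (growth_equilibrium_le hP l).
by have := growth_equilibrium_pos hP l; rewrite mxE; exact: ltW.
Qed.

Lemma in_box_history (Phi : field) s : (forall l x, 0 <= Phi l x <= M 0 l) ->
  in_box M (history Phi s).
Proof. by move=> PM l j; rewrite mxE. Qed.

Lemma growth_dist : exists K : R, forall i (h f : 'M[R]_(m, tau)) r,
  in_box M h -> in_box M f -> 0 <= r -> (forall l j, `|h l j - f l j| <= r) ->
  `|P i h - P i f| <= K * r.
Proof.
have [L L0 LP] := growth_lipschitz hP.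
exists (L * (m * tau)%N%:R) => i h f r hh hf r0 hr.
apply: le_trans (LP i h f hh hf) _; rewrite -mulrA ler_wpM2l ?(ltW L0) //.
apply: (@le_trans _ _ (\sum_(l < m) \sum_(j < tau) r)).
  by apply: ler_sum => l _; apply: ler_sum => j _.
by rewrite !sumr_const !card_ord -mulrnA mulr_natl mulnC.
Qed.

Lemma growth_cvg (X : Type) (Fl : set_system X) (FFl : Filter Fl) i
    (h_ : X -> 'M[R]_(m, tau)) (h : 'M[R]_(m, tau)) :
  (forall x, in_box M (h_ x)) -> in_box M h ->
  (forall l j, h_ x l j @[x --> Fl] --> h l j) ->
  P i (h_ x) @[x --> Fl] --> P i h.
Proof.
move=> bh_ bh hc; have [K KP] := growth_dist.
apply/cvgrPdist_le => e e0; have K1 : 0 < `|K| + 1 by rewrite ltr_wpDl.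
have r0 : 0 < e / (`|K| + 1) by rewrite divr_gt0.
have : \forall x \near Fl, forall l j, `|h l j - h_ x l j| <= e / (`|K| + 1).
  apply: filter_forall => l; apply: filter_forall => j.
  by have /cvgrPdist_le := hc l j; apply.
apply: filterS => x hx; apply: le_trans (KP i _ _ _ bh (bh_ x) (ltW r0) hx) _.
rewrite mulrCA -[leRHS]mulr1 ler_wpM2l ?(ltW e0) // ler_pdivrMr // mul1r.
by have := ler_norm K; lra.
Qed.

Lemma continuous_growth_history i (Phi : field) :
  (forall l x, 0 <= Phi l x <= M 0 l) -> (forall l, unif_continuous (Phi l)) ->
  continuous (fun s => P i (history Phi s)).
Proof.
move=> PM Puc s; apply: growth_cvg => [t||l j]; try exact: in_box_history.
rewrite mxE; under eq_fun do rewrite mxE.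
have Pc : continuous (Phi l).
  move=> x; apply/cvgrPdist_lt => e e0.
  have [d d0 dP] := proj1 (unif_continuous_realP _) (Puc l) e e0.
  by apply/nbhs_ballP; exists d => // y; exact: dP.
apply: (continuous_comp (f := fun t => t - (tau - j.+1)%:R * c)); last exact: Pc.
by apply: continuousB => //; exact: cvg_cst.
Qed.
End ProfileOperator.

Section Kernel.
Variables (R : realType) (k : R -> R) (c : R).
Hypothesis hk : kernel_assumptions k.
Local Notation cmu := (@completed_lebesgue_measure R).
Local Notation cR := (caratheodory_type ((wlength (@idfun R))^*)%mu).

(** Evenness turns the reflected kernels of the convolution into translates. *)
Lemma kernel_translateE xi s : k (xi - s - c) = k (s + (c - xi)).
Proof. by rewrite (kernel_even hk); congr k; ring. Qed.

Lemma kernel_shift_integrable xi :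
  cmu.-integrable setT (EFin \o (fun s : R => k (xi - s - c))).
Proof.
rewrite (_ : EFin \o _ = (fun s : R => (EFin \o k) (s + (c - xi)))).
  exact: integrable_translate (kernel_integrable hk).
by apply/funext => s /=; rewrite kernel_translateE.
Qed.

Lemma measurable_kernel : measurable_fun [set: cR] (k : cR -> R).
Proof. by apply/measurable_EFinP; have /integrableP[] := kernel_integrable hk. Qed.

Lemma kernel_shift_mass xi : \int[cmu]_s (k (xi - s - c)) = 1.
Proof.
have mk : measurable_fun [set: cR] (fun s : cR => (k s)%:E).
  by apply/measurable_EFinP; exact: measurable_kernel.
have k0 (s : cR) : (0 <= (k s)%:E)%E by rewrite lee_fin (kernel_ge0 hk).
have H := etrans (ge0_integral_translate (c - xi) mk k0) (kernel_mass1 hk).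
rewrite /Rintegral -[RHS]/(fine 1%E); congr fine; rewrite -{}H.
by apply: eq_integral => s _; rewrite kernel_translateE.
Qed.

(** Convolution by k against a function bounded by B is B-Lipschitz for this
    pseudometric, whatever the regularity of that function. *)
Definition kernel_dist x y := \int[cmu]_s `|k (x - s - c) - k (y - s - c)|.

Lemma kernel_dist_small (e : R) : 0 < e -> exists2 r : R, 0 < r &
  forall x y, `|x - y| < r -> kernel_dist x y <= e.
Proof.
move=> e0; have [r r0 rP] := integrable_translation_continuous (kernel_integrable hk) e0.
exists r => // x y xy; rewrite /kernel_dist /Rintegral -[e]/(fine e%:E).
pose G (u : cR) := (`|k ((u : R) + (y - x)) - k u|)%:E.
have mkt : measurable_fun [set: cR] (fun u : cR => k ((u : R) + (y - x))).
  exact: (measurableT_comp measurable_kernel (measurable_translate (y - x))).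
have mG : measurable_fun [set: cR] G.
  exact: measurable_EFin_dist mkt measurable_kernel.
have G0 (u : cR) : (0 <= G u)%E by rewrite lee_fin.
have GE := ge0_integral_translate (c - y) mG G0.
have -> : (\int[cmu]_s (`|k (x - s - c) - k (y - s - c)|)%:E)%E = (\int[cmu]_x G x)%E.
  rewrite -{}GE; apply: eq_integral => s _; rewrite /G !kernel_translateE.
  by have -> : (s : R) + (c - y) + (y - x) = (s : R) + (c - x) by ring.
have Ge : (\int[cmu]_x G x <= e%:E)%E by apply: rP; rewrite distrC.
have GI : (\int[cmu]_x G x)%E \is a fin_num.
  by rewrite ge0_fin_numE ?integral_ge0 // (le_lt_trans Ge) // ltry.
by rewrite fine_le.
Qed.

Lemma kernel_dist_ge0 x y : 0 <= kernel_dist x y.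
Proof. exact: Rintegral_ge0. Qed.

Lemma kernel_dist_sym x y : kernel_dist x y = kernel_dist y x.
Proof. by apply: eq_Rintegral => s _; rewrite distrC. Qed.

Lemma kernel_dist_tri x y z : kernel_dist x z <= kernel_dist x y + kernel_dist y z.
Proof.
have kd u v := integrable_distB (kernel_shift_integrable u) (kernel_shift_integrable v).
rewrite /kernel_dist -RintegralD //; [|exact: kd|exact: kd].
apply: le_Rintegral => //; first exact: kd.
  by apply: (integrableD measurableT (kd x y) (kd y z)).
by move=> s _; exact: ler_distD.
Qed.
End Kernel.

(** * Existence of a profile *)

(* MathComp-Analysis. A positive solution is one in the positive cone, i.e. a
   componentwise nonnegative one. *)
Theorem theorem3p5 (R : realType) (m tau : nat)
    (P : 'I_m -> 'M[R]_(m, tau) -> R) (M E : 'rV[R]_m) (k : 'I_m -> R -> R)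
    (c : R) (Phi_up Phi_lo : R -> 'rV[R]_m)
    (hP : growth_assumptions P M E)
    (hk : forall i : 'I_m, kernel_assumptions (k i))
    (hc : 0 < c)
    (hPhi : generalized_upper_lower P k M c Phi_up Phi_lo) :
  exists Phi : R -> 'rV[R]_m,
    [/\ BUC Phi,
        wave_profile_solution P k c Phi,
        forall x : R, vec_le 0 (Phi x),
        fun_le Phi_lo Phi
      & fun_le Phi Phi_up].
Proof.
have [[/unif_continuous_rowP up_uc _] up_box] := gul_upper hPhi.
have [[/unif_continuous_rowP lo_uc _] lo_box] := gul_lower hPhi.
pose lo (l : 'I_m) x := Phi_lo x 0 l; pose up (l : 'I_m) x := Phi_up x 0 l.
pose F (Phi : 'I_m -> R -> R) i xi := profile_integral P k c (fun l _ => Phi l) i xi.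
pose d l x y := M 0 l * kernel_dist (k l) c x y.
have M0 l : 0 <= M 0 l by exact: growth_M_ge0 hP l.
have lo_ge0 l x : 0 <= lo l x by have [/(_ l)] := lo_box x; rewrite mxE.
have up_leM l x : up l x <= M 0 l by have [_ /(_ l)] := up_box x.
have lo_up l x : lo l x <= up l x by exact: (gul_ordered hPhi).
have F_between Phi : between lo up Phi -> forall l x, lo l x <= F Phi l x <= up l x.
  move=> [Puc Plu] l x.
  exact: (gul_between hPhi (psi := fun l _ => Phi l)
    (fun l _ => Puc l) (fun l _ x => Plu l x) l x).
have Pbox Phi : between lo up Phi -> forall l x, 0 <= Phi l x <= M 0 l.
  move=> [_ Plu] l x; have /andP[h1 h2] := Plu l x.
  by rewrite (le_trans (lo_ge0 l x) h1) (le_trans h2).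
pose Q Phi i s := P i (delayed_args c (fun l (_ : 'I_tau) => Phi l) s).
have Q_box Phi : between lo up Phi -> forall s,
    in_box M (delayed_args c (fun l (_ : 'I_tau) => Phi l) s).
  by move=> bP s; apply: in_box_history; exact: Pbox.
have Q_bound Phi : between lo up Phi -> forall i s, `|Q Phi i s| <= M 0 i.
  move=> bP i s; have /andP[Q0 QM] := growth_bounded hP i (Q_box Phi bP s).
  by rewrite ger0_norm.
have Q_meas Phi : between lo up Phi -> forall i,
    measurable_fun [set: caratheodory_type ((wlength (@idfun R))^*)%mu] (Q Phi i).
  move=> bP i; apply: measurable_completed.
  by apply: (continuous_growth_history hP) (Pbox Phi bP) _; case: bP.
have F_lip Phi : between lo up Phi -> forall l x y, `|F Phi l x - F Phi l y| <= d l x y.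
  move=> bP l x y; apply: Rintegral_mul_weight_dist (Q_meas Phi bP l) (Q_bound Phi bP l) _ _.
    exact: kernel_shift_integrable.
  exact: kernel_shift_integrable.
have [K KP] := growth_dist hP.
have F_sup Phi Psi r : between lo up Phi -> between lo up Psi -> 0 <= r ->
    (forall l x, `|Phi l x - Psi l x| <= r) ->
    forall l x, `|F Phi l x - F Psi l x| <= K * r.
  move=> bP bQ r0 PQ l x.
  rewrite -[leRHS]mulr1 -(kernel_shift_mass c (hk l) x).
  apply: (Rintegral_mul_fun_dist (Q_meas Phi bP l) (Q_meas Psi bQ l)
    (Q_bound Phi bP l) (Q_bound Psi bQ l)).
  - exact: kernel_shift_integrable.
  - by move=> s; exact: kernel_ge0.
  - move=> s; apply: KP => // [||l' j]; last by rewrite !mxE.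
      exact: Q_box.
    exact: Q_box.
have F_cvg Phi_ Phi : (forall n, between lo up (Phi_ n)) -> between lo up Phi ->
    (forall l x, Phi_ n l x @[n --> \oo] --> Phi l x) ->
    forall l x, F (Phi_ n) l x @[n --> \oo] --> F Phi l x.
  move=> bP_ bP Pc l x.
  apply: (cvg_Rintegral_mul (fun n => Q_meas (Phi_ n) (bP_ n) l) (Q_meas Phi bP l)
    (fun n => Q_bound (Phi_ n) (bP_ n) l)).
    exact: kernel_shift_integrable.
  move=> s; apply: (growth_cvg hP) => [n||l' j].
  - exact: Q_box.
  - exact: Q_box.
  - by rewrite mxE; under eq_fun do rewrite mxE; exact: Pc.
have d_ge0 l x y : 0 <= d l x y by rewrite mulr_ge0 ?kernel_dist_ge0.
have d_sym l x y : d l x y = d l y x by rewrite /d kernel_dist_sym.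
have d_tri l x y z : d l x z <= d l x y + d l y z.
  by rewrite -mulrDr ler_wpM2l // kernel_dist_tri.
have d_small l (e : R) : 0 < e -> exists2 r : R, 0 < r &
    forall x y, `|x - y| < r -> d l x y <= e.
  move=> e0; have M1 : 0 < M 0 l + 1 by rewrite ltr_wpDl.
  have [r r0 rP] := kernel_dist_small c (hk l) (divr_gt0 e0 M1).
  exists r => // x y /rP h.
  apply: le_trans (ler_wpM2l (M0 l) h) _.
  by rewrite mulrCA -[leRHS]mulr1 ler_wpM2l ?(ltW e0) // ler_pdivrMr // mul1r lerDl.
have [Phi [bPhi PhiE]] := fixed_point_between lo_uc up_uc lo_ge0 lo_up up_leM
  d_ge0 d_sym d_tri d_small F_between F_lip F_sup F_cvg.
pose U x : 'rV[R]_m := \row_l Phi l x.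
have UE l : (fun x => U x 0 l) = Phi l by apply/funext => x; rewrite mxE.
have [Puc Plu] := bPhi.
exists U; split.
- split; first by apply/unif_continuous_rowP => l; rewrite UE.
  by apply: (@bounded_fun_row _ _ _ M) => x l; rewrite mxE; exact: Pbox.
- move=> i xi; rewrite mxE PhiE /F; congr (profile_integral P k c _ i xi).
  by apply/funext => l; apply/funext => _; rewrite UE.
- by move=> x l; rewrite !mxE; have /andP[] := Pbox Phi bPhi l x.
- by move=> x l; rewrite mxE; have /andP[] := Plu l x.
- by move=> x l; rewrite mxE; have /andP[] := Plu l x.
Qed.
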